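(* Let $M$ be a left $R$-module that is projective in $\sigma[M]$ and semiprime. If $M$ satisfies ACC on annihilators and every submodule $0\neq N\subseteq M$ contains a uniform submodule, then there is a bijective correspondence between $\mathcal{E}_{\chi(M)}(M)$ and $\mathrm{Spec}^{Min}(M)$.
   Context: $R$ is an associative ring with unity; modules are unitary left $R$-modules. For a left $R$-module $M$, a module $X$ is $M$-generated if it is an epimorphic image of a direct sum of copies of $M$, and $\sigma[M]$ is the full subcategory of left $R$-modules isomorphic to a submodule of an $M$-generated module. $M$ is projective in $\sigma[M]$ if $\mathrm{Hom}_R(M,-)$ is exact on short exact sequences in $\sigma[M]$. A submodule $N\subseteq M$ is fully invariant if $f(N)\subseteq N$ for all $f\in \mathrm{End}_R(M)$. For submodules $K,L$ of $M$, $K_ML=\sum\{f(K)\mid f\in \mathrm{Hom}_R(M,L)\}$. A fully invariant submodule $N\neq M$ is prime in $M$ if for all fully invariant submodules $K,L$ of $M$, $K_ML\subseteq N$ implies $K\subseteq N$ or $L\subseteq N$; it is semiprime in $M$ if for every fully invariant submodule $K$ of $M$, $K_MK\subseteq N$ implies $K\subseteq N$. $M$ is a semiprime module if $0$ is semiprime in $M$ (in particular $M\ne 0$). A minimal prime in $M$ is a submodule prime in $M$ that is minimal under inclusion among the submodules prime in $M$; $\mathrm{Spec}^{Min}(M)$ is the set of minimal primes in $M$. $M$ satisfies ACC on annihilators if the set $\{\bigcap_{f\in X}\ker f\mid X\subseteq \mathrm{End}_R(M)\}$ satisfies the ascending chain condition. A module is uniform if it is nonzero and any two of its nonzero submodules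 have nonzero intersection. Injective hulls exist in $\sigma[M]$; $\widehat{X}$ denotes the injective hull of $X$ in $\sigma[M]$. $\chi(M)$ is the greatest hereditary torsion theory on $\sigma[M]$ for which $M$ is torsion free (the one cogenerated by $M$): $N\in\sigma[M]$ is $\chi(M)$-torsion iff $\mathrm{Hom}_R(N,\widehat{M})=0$, and $\chi(M)$-torsion free iff it has no nonzero $\chi(M)$-torsion submodule. For a hereditary torsion theory $\tau$ on $\sigma[M]$, $\mathcal{E}_{\tau}(M)$ denotes a complete set of representatives of isomorphism classes of indecomposable $\tau$-torsion free modules that are injective in $\sigma[M]$. *)

(* Defs.v *)
From HB Require Import structures.
From mathcomp Require Import all_boot all_algebra.
From mathcomp Require Import boolp classical_sets functions cardinality.

Set Implicit Arguments.
Unset Strict Implicit.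
Unset Printing Implicit Defensive.

Import GRing.Theory.

Local Open Scope classical_set_scope.
Local Open Scope ring_scope.

Record submodule (R : pzRingType) (M : lmodType R) := Submodule {
  subm_set :> set M;
  subm_closed : submod_closed [in subm_set] }.

Lemma submodule_ext (R : pzRingType) (M : lmodType R) (N L : submodule M) :
  N = L :> set M -> N = L.
Proof.
case: N L => [N hN] [L hL] /= E; case: L / E hL => hL.
by congr Submodule; exact: Prop_irrelevance.
Qed.

(* A submodule N of M as a module in its own right, [subm_type N], with
   inclusion map [subm_val]. *)
Section SubmoduleAsModule.
Variables (R : pzRingType) (M : lmodType R) (N : submodule M).

Definition subm_pred : {pred M} := [in subm_set N].

HB.instance Definition _ := GRing.isSubmodClosed.Build R M subm_pred
  (GRing.submod_closed_semi (subm_closed N)).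

Record subm_type := SubmType { subm_val : M; _ : subm_val \in subm_pred }.

HB.instance Definition _ := [isSub for subm_val].
HB.instance Definition _ := [Choice of subm_type by <:].
HB.instance Definition _ := [SubChoice_isSubLmodule of subm_type by <:].

End SubmoduleAsModule.

Fact subm0_closed (R : pzRingType) (M : lmodType R) :
  submod_closed [in [set 0 : M]].
Proof.
split=> [|a u v]; first by apply/mem_set.
by move=> /set_mem -> /set_mem ->; apply/mem_set; rewrite scaler0 addr0.
Qed.

Definition subm0 (R : pzRingType) (M : lmodType R) : submodule M :=
  Submodule (@subm0_closed R M).

(* Universe constraints of the library rule out [set (lmodType R)]. *)
Definition module_class (R : pzRingType) := lmodType R -> Prop.

Definition nonzero_module (R : pzRingType) (X : lmodType R) : Prop :=
  exists x : X, x != 0.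

Definition isomorphic (R : pzRingType) (X Y : lmodType R) : Prop :=
  exists f : {linear X -> Y}, bijective f.

(* The direct sum of I copies of M: functions I -> M of finite support. *)
Section DirectSumOfCopies.
Variables (R : pzRingType) (M : lmodType R) (I : Type).

Definition finsupp : set (I -> M) := [set g | finite_set [set i | g i != 0]].

Fact finsupp_closed : submod_closed [in finsupp].
Proof.
split=> [|a u v].
  apply/mem_set; rewrite /finsupp /=.
  by apply: (sub_finite_set (B := set0)) => // i /=; rewrite eqxx.
move=> /set_mem fu /set_mem fv; apply/mem_set.
apply: (sub_finite_set (B := [set i | u i != 0] `|` [set i | v i != 0])).
  move=> i; rewrite /= => h; apply/orP; apply: contraNT h.
  rewrite negb_or !negbK => /andP[/eqP ui /eqP vi].
  by change (a *: u i + v i == 0); rewrite ui vi scaler0 addr0.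
by rewrite finite_setU.
Qed.

Definition copies : lmodType R := subm_type (Submodule finsupp_closed).

End DirectSumOfCopies.

Section SigmaM.
Variables (R : pzRingType) (M : lmodType R).

Definition generated (X : lmodType R) : Prop :=
  exists (I : Type) (p : {linear copies M I -> X}), range p = setT.

Definition in_sigma (X : lmodType R) : Prop :=
  exists (G : lmodType R) (N : submodule G),
    generated G /\ isomorphic X (subm_type N).

Definition short_exact (A B C : lmodType R)
    (f : {linear A -> B}) (g : {linear B -> C}) : Prop :=
  [/\ injective f, range f = [set b | g b = 0] & range g = setT].

(* Exactness of 0 -> Hom(P, A) -> Hom(P, B) -> Hom(P, C) -> 0. *)
Definition hom_short_exact (P A B C : lmodType R)
    (f : {linear A -> B}) (g : {linear B -> C}) : Prop :=
  [/\ (forall u v : {linear P -> A}, f \o u =1 f \o v -> u =1 v),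
      (forall v : {linear P -> B},
         (exists u : {linear P -> A}, f \o u =1 v) <-> (forall x, g (v x) = 0))
    & (forall w : {linear P -> C}, exists v : {linear P -> B}, g \o v =1 w)].

Definition projective_in_sigma (P : lmodType R) : Prop :=
  forall (A B C : lmodType R) (f : {linear A -> B}) (g : {linear B -> C}),
    in_sigma A -> in_sigma B -> in_sigma C ->
    short_exact f g -> hom_short_exact P f g.

Definition injective_in_sigma (E : lmodType R) : Prop :=
  in_sigma E /\
  forall (A B : lmodType R) (i : {linear A -> B}) (u : {linear A -> E}),
    in_sigma A -> in_sigma B -> injective i ->
    exists v : {linear B -> E}, v \o i =1 u.

Definition essential_mono (X E : lmodType R) (i : {linear X -> E}) : Prop :=
  injective i /\
  forall L : submodule E, L <> [set 0] :> set E ->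
    range i `&` L <> [set 0].

Definition injective_hull (X E : lmodType R) (i : {linear X -> E}) : Prop :=
  injective_in_sigma E /\ essential_mono i.

(* The torsion class of chi(M); the hull of M is unique up to isomorphism, so
   quantifying over all of its models is the same as fixing one. *)
Definition chi : module_class R := fun N =>
  in_sigma N /\
  forall (E : lmodType R) (i : {linear M -> E}), injective_hull i ->
    forall (f : {linear N -> E}) (x : N), f x = 0.

(* A torsion theory on sigma[M] is represented by its class of torsion
   modules. *)
Definition torsion_free (tau : module_class R) (X : lmodType R) : Prop :=
  in_sigma X /\
  forall N : submodule X, tau (subm_type N) -> N = [set 0] :> set X.

End SigmaM.

Section Indecomposable.
Variable R : pzRingType.

Definition uniform (X : lmodType R) : Prop :=
  nonzero_module X /\
  forall A B : submodule X, A <> [set 0] :> set X -> B <> [set 0] :> set X ->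
    A `&` B <> [set 0].

Definition direct_sum_of (X : lmodType R) (A B : submodule X) : Prop :=
  A `&` B = [set 0] /\
  forall x : X, exists a b, [/\ subm_set A a, subm_set B b & x = a + b].

Definition indecomposable (X : lmodType R) : Prop :=
  nonzero_module X /\
  forall A B : submodule X, direct_sum_of A B ->
    A = [set 0] :> set X \/ B = [set 0] :> set X.

End Indecomposable.

Definition indec_torsion_free_injective (R : pzRingType) (M : lmodType R)
    (tau : module_class R) : module_class R := fun X =>
  [/\ indecomposable X, torsion_free M tau X & injective_in_sigma M X].

Definition complete_reps (R : pzRingType) (C S : module_class R) : Prop :=
  [/\ (forall X, S X -> C X),
      (forall X, C X -> exists2 Y, S Y & isomorphic X Y)
    & (forall X Y, S X -> S Y -> isomorphic X Y -> X = Y)].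

(* [is_Etau M tau S]: S is a possible choice of E_tau(M). *)
Definition is_Etau (R : pzRingType) (M : lmodType R)
    (tau S : module_class R) : Prop :=
  complete_reps (indec_torsion_free_injective M tau) S.

Section IsomorphismClasses.
Variable R : pzRingType.
Implicit Types X Y Z : lmodType R.

Lemma isomorphic_refl X : isomorphic X X.
Proof. by exists idfun; exists idfun. Qed.

Lemma isomorphic_sym X Y : isomorphic X Y -> isomorphic Y X.
Proof.
case=> f [g fK gK].
have lin : linear g by exact: can2_linear fK gK.
pose m := GRing.isLinear.Build R Y X *:%R g lin.
pose h : {linear Y -> X} := HB.pack g m.
by exists h; exists f.
Qed.

Lemma isomorphic_trans X Y Z :
  isomorphic X Y -> isomorphic Y Z -> isomorphic X Z.
Proof. by case=> f bf [g bg]; exists (g \o f); apply: bij_comp. Qed.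

Lemma complete_reps_exist (C : module_class R) :
  (forall X Y, C X -> isomorphic X Y -> C Y) -> exists S, complete_reps C S.
Proof.
move=> Ciso.
pose rep (c : lmodType R -> Prop) (h : exists X, c X) := projT1 (cid h).
have repP c h : c (rep c h) by exact: projT2 (cid h).
have ne X : exists Y, isomorphic X Y by exists X; exact: isomorphic_refl.
exists (fun Y => exists2 X, C X & Y = rep (isomorphic X) (ne X)); split.
- by move=> _ [X CX ->]; apply: (Ciso X) => //; exact: repP.
- by move=> X CX; exists (rep (isomorphic X) (ne X)); [exists X | exact: repP].
- move=> _ _ [X CX ->] [X' CX' ->] h.
  have XX' : isomorphic X X'.
    apply: isomorphic_trans (repP _ _) _.
    by apply: isomorphic_trans h _; apply: isomorphic_sym; exact: repP.
  have E : isomorphic X = isomorphic X'.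
    apply/funext => Z; apply/propext; split; apply: isomorphic_trans => //.
    exact: isomorphic_sym.
  move: (ne X) (ne X'); rewrite E => p q.
  by rewrite (Prop_irrelevance p q).
Qed.

End IsomorphismClasses.

Section Primes.
Variables (R : pzRingType) (M : lmodType R).

Definition fully_invariant (N : submodule M) : Prop :=
  forall f : {linear M -> M}, f @` N `<=` N.

(* K_M L: the sum of the images f(K), f : M -> L, i.e. the set of all finite
   sums of elements of these images. *)
Definition subm_prod (K L : submodule M) : set M := [set x |
  exists (n : nat) (f : 'I_n -> {linear M -> subm_type L}) (k : 'I_n -> M),
    (forall i, subm_set K (k i)) /\ x = \sum_(i < n) subm_val (f i (k i))].

Definition prime_in (N : submodule M) : Prop :=
  [/\ fully_invariant N, N <> setT :> set M &
      forall K L : submodule M, fully_invariant K -> fully_invariant L ->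
        subm_prod K L `<=` N -> K `<=` N \/ L `<=` N].

Definition semiprime_in (N : submodule M) : Prop :=
  [/\ fully_invariant N, N <> setT :> set M &
      forall K : submodule M, fully_invariant K ->
        subm_prod K K `<=` N -> K `<=` N].

Definition semiprime_module : Prop := semiprime_in (subm0 M).

Definition SpecMin : set (submodule M) := [set P |
  prime_in P /\ forall Q : submodule M, prime_in Q -> Q `<=` P -> Q = P].

Definition annihilators : set (set M) := [set A |
  exists X : set {linear M -> M}, A = \bigcap_(f in X) [set x | f x = 0]].

End Primes.

Arguments SpecMin {R} M _.
Arguments annihilators {R} M _.

Definition ACC (T : Type) (F : set (set T)) : Prop :=
  forall A : nat -> set T, (forall n, F (A n)) ->
    (forall n, A n `<=` A n.+1) ->
    exists n, forall m, (n <= m)%N -> A m = A n.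

(* Main.v *)
Require Import Defs.
From HB Require Import structures.
From mathcomp Require Import all_boot all_algebra.
From mathcomp Require Import archimedean.
From mathcomp Require Import boolp classical_sets functions cardinality.
From mathcomp Require Import fsbigop.

(** The bijection sends an indecomposable torsion free injective [X] to the
    annihilator [ann V], the set of elements killed by all maps [M -> V], of any
    uniform submodule [V] of [M] that embeds in [X].

    The product [mprod K L], generated by the images [f K] of the maps
    [f : M -> L], is associative because [M] is projective: a map into
    [mprod L U], a sum of images of [L], lifts to a direct sum of copies of [L]
    ([mprod_factor], [mprodA]). Semiprimeness then extends from fully invariant
    submodules to all submodules ([semiprime_mprod]), so that the relation
    [mprod K L = 0] is symmetric ([mprod_sym]).

    The ascending chain condition makes [M] nonsingular: an endomorphism with
    essential kernel vanishes ([essential_kernel_eq0]). Hence all nonzero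
    submodules of a uniform [U] have the annihilator of [U] ([ann_uniform]),
    which makes [ann U] a prime ([prime_ann]). It is a minimal one: a prime below
    [ann U] contains the product of [ann U] and [U], which is zero, but does not
    contain [U]; so it contains [ann U]. Conversely every minimal prime is some
    [ann U] ([SpecMin_is_ann]): intersecting annihilators of uniform submodules
    until the chain condition stops the process gives [0], and a prime that
    contains such an intersection contains one of its terms.

    On the side of injectives, a torsion free [X] has a nonzero map to the hull
    of [M]; over the part of its image inside [M], projectivity gives a map back
    from [M] to [X], and nonsingularity makes it injective on some uniform [V]
    ([class_uniform]). As [X] is indecomposable, it is the hull of [V], so any two
    such [V] share a nonzero submodule up to isomorphism, and [ann V] depends only
    on [X] ([class_ann]). If [ann U = ann V] then [V] embeds in [U]
    ([ann_eq_embed]), and the hulls are isomorphic ([class_iso]). Finally the hull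
    of a uniform [U] lies in the class ([class_hull]).

    Hulls must be constructed. Every module embeds in an injective one, coinduced
    from a power of [Q/Z] ([enough_injectives]); the trace of [M] in it is
    injective in sigma[M] ([sigma_injective_exists]), and a maximal essential
    extension inside an injective is a retract of it ([hull_in_injective]). *)

Set Implicit Arguments.
Unset Strict Implicit.
Unset Printing Implicit Defensive.

Import GRing.Theory Num.Theory.

Local Open Scope classical_set_scope.
Local Open Scope quotient_scope.
Local Open Scope ring_scope.

(** * Submodules *)

Definition linear_map (R : pzRingType) (X Y : lmodType R) (f : X -> Y)
    (h : linear f) : {linear X -> Y} :=
  HB.pack f (GRing.isLinear.Build R X Y *:%R f h).

Section Submodules.
Variable R : pzRingType.
Implicit Types X Y : lmodType R.

(** [submod_closed] for a set of elements instead of a boolean predicate. *)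
Definition linear_stable X (P : set X) :=
  P 0 /\ forall a u v, P u -> P v -> P (a *: u + v).

Fact linear_stable_closed X (P : set X) :
  linear_stable P -> submod_closed [in P].
Proof.
move=> [P0 Pl]; split=> [|a u v]; first exact: mem_set.
by move=> /set_mem Pu /set_mem Pv; apply: mem_set; exact: Pl.
Qed.

Definition mk_submodule X (P : set X) (h : linear_stable P) : submodule X :=
  Submodule (linear_stable_closed h).

Section Closure.
Variables (X : lmodType R) (N : submodule X).

Lemma subm_stable : linear_stable N.
Proof.
have [N0 Nl] := subm_closed N; split; first exact: set_mem N0.
by move=> a u v Nu Nv; apply: set_mem; apply: Nl; exact: mem_set.
Qed.

Lemma subm_0 : subm_set N 0. Proof. exact: subm_stable.1. Qed.

Lemma subm_lin a u v : subm_set N u -> subm_set N v -> subm_set N (a *: u + v).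
Proof. exact: subm_stable.2. Qed.

Lemma subm_scale a u : subm_set N u -> subm_set N (a *: u).
Proof. by move=> Nu; rewrite -[_ *: _]addr0; apply: subm_lin => //; exact: subm_0. Qed.

Lemma subm_add u v : subm_set N u -> subm_set N v -> subm_set N (u + v).
Proof. by move=> Nu Nv; rewrite -[u]scale1r; exact: subm_lin. Qed.

Lemma subm_opp u : subm_set N u -> subm_set N (- u).
Proof. by move=> Nu; rewrite -scaleN1r; exact: subm_scale. Qed.

Lemma subm_sub u v : subm_set N u -> subm_set N v -> subm_set N (u - v).
Proof. by move=> Nu Nv; apply: subm_add => //; exact: subm_opp. Qed.

Lemma subm_eq0 : (forall x, subm_set N x -> x = 0) -> N = [set 0] :> set X.
Proof. by move=> h; apply/seteqP; split=> [x /h|_ ->] //; exact: subm_0. Qed.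

Lemma subm_neq0 : N <> [set 0] :> set X -> exists2 x, subm_set N x & x != 0.
Proof.
move=> hN; apply: contrapT => h; apply/hN/subm_eq0 => x Nx.
by apply: contrapT => x0; apply: h; exists x => //; exact/eqP.
Qed.

End Closure.

Fact subm_preim_stable X Y (f : {linear X -> Y}) (N : submodule Y) :
  linear_stable [set x | subm_set N (f x)].
Proof.
split=> [|a u v /= Nu Nv]; first by rewrite /= linear0; exact: subm_0.
by rewrite linearP; exact: subm_lin.
Qed.
Definition subm_preim X Y f N := mk_submodule (@subm_preim_stable X Y f N).

Fact subm_image_stable X Y (f : {linear X -> Y}) (N : submodule X) :
  linear_stable [set f x | x in N].
Proof.
split; first by exists 0; [exact: subm_0 | exact: linear0].
move=> a _ _ [u Nu <-] [v Nv <-]; exists (a *: u + v); last by rewrite linearP.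
exact: subm_lin.
Qed.
Definition subm_image X Y f N := mk_submodule (@subm_image_stable X Y f N).

Fact setT_stable X : linear_stable (@setT X). Proof. by []. Qed.
Definition subm_full X := mk_submodule (@setT_stable X).

Definition ker X Y (f : {linear X -> Y}) : submodule X := subm_preim f (subm0 Y).
Definition im X Y (f : {linear X -> Y}) : submodule Y := subm_image f (subm_full X).

Fact setI_stable X (N L : submodule X) : linear_stable (N `&` L).
Proof.
split=> [|a u v [Nu Lu] [Nv Lv]]; first by split; exact: subm_0.
by split; exact: subm_lin.
Qed.
Definition subm_cap X N L := mk_submodule (@setI_stable X N L).

Fact sum_stable X (N L : submodule X) :
  linear_stable [set x | exists n l, [/\ subm_set N n, subm_set L l & x = n + l]].
Proof.
split; first by exists 0, 0; rewrite addr0; split=> //; exact: subm_0.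
move=> a _ _ [n [l [Nn Ll ->]]] [n' [l' [Nn' Ll' ->]]].
exists (a *: n + n'), (a *: l + l'); split; try exact: subm_lin.
by rewrite scalerDr addrACA.
Qed.
Definition subm_sum X N L := mk_submodule (@sum_stable X N L).

Fact cyclic_stable X (x : X) : linear_stable [set r *: x | r in setT].
Proof.
split; first by exists 0 => //; exact: scale0r.
by move=> a _ _ [r _ <-] [s _ <-]; exists (a * r + s) => //; rewrite scalerDl scalerA.
Qed.
Definition cyclic X x := mk_submodule (@cyclic_stable X x).

Lemma cyclic_id X (x : X) : subm_set (cyclic x) x.
Proof. by exists 1 => //; exact: scale1r. Qed.

Lemma cyclic_sub X (x : X) (N : submodule X) : subm_set N x -> cyclic x `<=` N.
Proof. by move=> Nx _ [r _ <-]; exact: subm_scale. Qed.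

(** Zorn's lemma for submodules; [N0] bounds the empty chain. *)
Lemma max_submodule X (P : submodule X -> Prop) (N0 : submodule X) :
  P N0 ->
  (forall F : set (submodule X), F !=set0 -> (forall N, F N -> P N) ->
     (forall N L, F N -> F L -> N `<=` L \/ L `<=` N) ->
     forall L : submodule X, L = \bigcup_(N in F) N :> set X -> P L) ->
  exists2 N : submodule X, P N & forall L : submodule X, P L -> N `<=` L -> L `<=` N.
Proof.
move=> PN0 chainP; pose T := {N | P N}.
pose le (a b : T) : bool := `[< sval a `<=` sval b >].
have [|||[N PN] maxN] := @ZL_preorder T (exist _ N0 PN0) le.
- by move=> a; apply/asboolP.
- by move=> b a c /asboolP ab /asboolP bc; apply/asboolP; exact: (subset_trans ab bc).
- move=> A totA; have [[a0 Aa0]|Ae] := pselect (A !=set0); last first.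
    by exists (exist _ N0 PN0) => s As; case: Ae; exists s.
  pose F : set (submodule X) := [set sval a | a in A].
  have totF N L : F N -> F L -> N `<=` L \/ L `<=` N.
    by move=> [a Aa <-] [b Ab <-]; case: (totA _ _ Aa Ab) => /asboolP; [left|right].
  have st : linear_stable (\bigcup_(N in F) N).
    split; first by exists (sval a0); [exists a0 | exact: subm_0].
    move=> r u v [N FN Nu] [L FL Lv].
    have [h|h] := totF _ _ FN FL; [exists L|exists N] => //;
      by apply: subm_lin => //; exact: h.
  have PL : P (mk_submodule st).
    apply: (chainP F) => //; first by exists (sval a0); exists a0.
    by move=> _ [a _ <-]; exact: svalP.
  exists (exist _ _ PL) => s As; apply/asboolP => x sx /=.
  by exists (sval s) => //; exists s.
exists N => // L PL NL.
by have /asboolP := maxN (exist _ L PL) (introT (asboolP _) NL).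
Qed.

End Submodules.

(** * Baer's criterion *)

Section Baer.
Variables (R : pzRingType) (E : lmodType R).

(** With [G] a submodule, this says that [G] is the graph of a partial map. *)
Definition functional (B : lmodType R) (G : set (B * E)) :=
  forall e, G (0, e) -> e = 0.

(** Baer's criterion phrased with graphs: the domain of [G] is a left ideal, and
    the partial map [G] on it extends to [r |-> r *: d]. *)
Definition baer := forall G : submodule (R^o * E)%type, functional G ->
  exists d : E, forall (r : R) (e : E), subm_set G (r : R^o, e) -> e = r *: d.

Hypothesis baerE : baer.

(** Take a maximal functional submodule above [G0]. It is defined at each [b]:
    the ideal of the [r] with [r *: b] in its domain carries a partial map to [E],
    and the [d] that Baer's criterion gives for it is a consistent value at [b]. *)
Lemma extend_graph (B : lmodType R) (G0 : submodule (B * E)%type) :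
  functional G0 ->
  exists v : {linear B -> E}, forall b e, subm_set G0 (b, e) -> v b = e.
Proof.
move=> G0f.
have [||G [GG0 Gf] maxG] := @max_submodule R (B * E)%type
    (fun G => G0 `<=` G /\ functional G) G0.
- by split.
- move=> F [N FN] FP _ L ->; split=> [x Gx|e [K FK]].
    by exists N => //; exact: (FP _ FN).1.
  by have [_] := FP _ FK; apply.
have tot b : exists e, subm_set G (b, e).
  pose lift (p : R^o * E) : B * E := ((p.1 : R) *: b, p.2).
  have linl : linear lift.
    move=> a [r e] [s d]; congr pair => /=.
    by rewrite scalerDl -scalerA.
  have [|d dP] := baerE (G := subm_preim (linear_map linl) G).
    by move=> e; rewrite /= /lift /= scale0r; exact: Gf.
  exists d; pose G1 := subm_sum G (cyclic (b, d)).
  have GG1 : G `<=` G1.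
    by move=> x Gx; exists x, 0; rewrite addr0; split=> //; exact: subm_0.
  suff G1f : functional G1.
    apply: (maxG G1 (conj (subset_trans GG0 GG1) G1f) GG1).
    by exists 0, (b, d); rewrite add0r; split=> //; [exact: subm_0|exact: cyclic_id].
  move=> e [[g1 g2] [_ [Gg [r _ <-]]]] [h1 h2].
  have {}h1 : 0 = g1 + r *: b := h1.
  have {}h2 : e = g2 + r *: d := h2.
  (* G contains (g1, g2) = (- r *: b, g2), so d satisfies g2 = - r *: d *)
  rewrite h2; suff -> : g2 = (- r) *: d by rewrite scaleNr addrC subrr.
  apply: dP; rewrite /= /lift /= scaleNr.
  suff -> : - (r *: b) = g1 by [].
  by apply/eqP; rewrite eq_sym -addr_eq0 -h1.
pose v b := projT1 (cid (tot b)).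
have vP b : subm_set G (b, v b) by exact: projT2 (cid (tot b)).
have uniq b e : subm_set G (b, e) -> v b = e.
  move=> Ge; apply/eqP; rewrite -subr_eq0; apply/eqP/Gf.
  by have := subm_sub (vP b) Ge; rewrite {1}/GRing.add /= /add_pair /= subrr.
have linv : linear v.
  by move=> a x y; apply: uniq; exact: (subm_lin a (vP x) (vP y)).
by exists (linear_map linv) => b e /GG0 /uniq.
Qed.

Lemma baer_extend (A B : lmodType R) (i : {linear A -> B}) (u : {linear A -> E}) :
  injective i -> exists v : {linear B -> E}, v \o i =1 u.
Proof.
move=> inji.
have ling : linear (fun a => (i a, u a)) by move=> a x y; rewrite !linearP.
have [|v vP] := @extend_graph B (im (linear_map ling)).
  move=> e [a _ [ia <-]]; suff -> : a = 0 by rewrite linear0.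
  by apply: inji; rewrite ia linear0.
by exists v => a; apply: vP; exists a.
Qed.

End Baer.

(** * Divisible groups and enough injectives *)

Lemma int_ideal_principal (I : submodule int^o) :
  exists2 k : nat, subm_set I k%:Z & forall n : int, subm_set I n -> (k %| n)%Z.
Proof.
have [exk|nok] := pselect (exists k, (0 < k)%N && `[< subm_set I k%:Z >]).
  have [k /andP[k0 /asboolP Ik] kmin] := ex_minnP exk.
  exists k => // n In; apply: contrapT => nkn.
  have nk0 : (0 < `|(n %% k%:Z)%Z|)%N.
    by rewrite absz_gt0; apply/eqP => n0; apply: nkn; exact/dvdz_mod0P.
  have nk : (`|(n %% k%:Z)%Z|%N)%:Z = (n %% k%:Z)%Z.
    by rewrite gez0_abs // modz_ge0 // eqz_nat -lt0n.
  have lek : (k <= `|(n %% k%:Z)%Z|)%N.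
    apply: kmin; rewrite nk0 nk; apply/asboolP.
    have -> : (n %% k%:Z)%Z = (- (n %/ k%:Z)%Z) * k%:Z + n.
      by rewrite {3}(divz_eq n k%:Z) mulNr addKr.
    exact: (subm_lin (- (n %/ k%:Z)%Z) Ik In).
  have := ltz_pmod n (k0 : (0 < k%:Z)%R).
  by rewrite -nk ltz_nat ltnNge lek.
exists 0; [exact: subm_0 | move=> n In].
rewrite dvd0z; apply: contrapT => /negP n0; apply: nok; exists `|n|%N.
by rewrite absz_gt0 n0; apply/asboolP; rewrite abszEsg; exact: (subm_scale (sgz n) In).
Qed.

Definition divisible (D : lmodType int) :=
  forall (k : nat) (d : D), (0 < k)%N -> exists e, d = k%:Z *: e.

Lemma divisible_baer (D : lmodType int) : divisible D -> baer D.
Proof.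
move=> divD G Gf.
have fstl : linear (fun p : int^o * D => p.1) by [].
have [k [[k' e0] Gk /= kE] kP] := int_ideal_principal (subm_image (linear_map fstl) G).
rewrite kE in Gk => {k' kE}.
have [d e0E] : exists d, e0 = k%:Z *: d.
  have [k0|] := posnP k; last exact: divD.
  by exists 0; rewrite scaler0; apply: Gf; move: Gk; rewrite k0.
exists d => r e Ge.
have /dvdzP[q rE] : (k %| r)%Z by apply: kP; exists (r, e).
rewrite rE -scalerA -e0E.
apply/eqP; rewrite -subr_eq0; apply/eqP/Gf.
have : subm_set G (- q * k%:Z + r, - q *: e0 + e) := subm_lin (- q) Gk Ge.
by rewrite rE mulNr addNr scaleNr addrC.
Qed.

Definition intQ : {pred rat} := fun q => q \is a Num.int.
Fact intQ_closed : zmod_closed intQ.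
Proof. by split=> [|u v]; rewrite !unfold_in; [exact: rpred0 | exact: rpredB]. Qed.
HB.instance Definition _ := GRing.isZmodClosed.Build rat intQ intQ_closed.
Definition QZ : lmodType int := zmodule (Quotient.quot intQ).

Definition piQZ (q : rat) : QZ := \pi_(Quotient.quot intQ) q.

Lemma piQZ_eq0 q : (piQZ q == 0) = (q \is a Num.int).
Proof.
have -> : 0 = piQZ 0 :> QZ by rewrite /piQZ raddf0.
by rewrite -[RHS]/(q \in intQ) -[q in RHS]subr0 Quotient.idealrBE.
Qed.

Fact piQZ_is_linear (k : int) q : piQZ (k%:~R * q) = k *: piQZ q.
Proof. by rewrite mulrzl scalezrE /piQZ raddfMz. Qed.

Lemma QZ_divisible : divisible QZ.
Proof.
move=> k d k0; exists (piQZ ((repr d : rat) / k%:R)).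
rewrite -piQZ_is_linear mulrCA mulfV ?mulr1 ?pnatr_eq0 -?lt0n //.
by rewrite /piQZ reprK.
Qed.

(** The cyclic group generated by [x] has a nonzero map to Q/Z, which extends to
    [B] by divisibility. If [x] has finite order [k], it may go to [1/k]. *)
Lemma QZ_cogenerator (B : lmodType int) (x : B) :
  x != 0 -> exists h : {linear B -> QZ}, h x != 0.
Proof.
move=> x0.
have mulxl : linear (fun n : int^o => n *: x) by move=> a m n; rewrite scalerDl scalerA.
have [k kx kP] := int_ideal_principal (ker (linear_map mulxl)).
have [d d0 dP] : exists2 d : QZ, d != 0 & forall n : int, n *: x = 0 -> n *: d = 0.
  have [k0|k0] := posnP k.
    (* x has infinite order: any nonzero value will do *)
    exists (piQZ (2%:R^-1)); first by rewrite piQZ_eq0.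
    by move=> n /kP; rewrite k0 dvd0z => /eqP ->; rewrite scale0r.
  exists (piQZ (k%:R^-1)).
    rewrite piQZ_eq0; apply/negP => /intrP[m mE].
    have : (m * k%:Z)%:~R = 1%:~R :> rat.
      by rewrite intrM -mE mulVf // pnatr_eq0 -lt0n.
    move=> /intr_inj mk; have : (k %| 1)%N.
      by apply/dvdnP; exists `|m|%N; rewrite -[k]/`|k%:Z|%N -abszM mk.
    by rewrite dvdn1 => /eqP kE; move: kx x0; rewrite kE /= scale1r => ->; rewrite eqxx.
  move=> n /kP /dvdzP[q ->].
  rewrite -scalerA -[k%:Z *: _]piQZ_is_linear mulfV ?pnatr_eq0 -?lt0n //.
  suff -> : piQZ 1 = 0 by rewrite scaler0.
  by apply/eqP; rewrite piQZ_eq0 rpred1.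
have linG : linear (fun n : int^o => (n *: x, n *: d)).
  by move=> a m n; congr pair; rewrite /= scalerDl -scalerA.
have [|h hP] := extend_graph (divisible_baer QZ_divisible) (G0 := im (linear_map linG)).
  by move=> e [n _ [/dP nd <-]].
exists h; rewrite (hP x d) //; exists 1 => //=.
by rewrite !scale1r.
Qed.

Lemma additive_int_linear (X : zmodType) (D : lmodType int) (g : X -> D) :
  zmod_morphism g -> linear (g : zmodule X -> D).
Proof.
move=> gB; pose ga : {additive X -> D} := HB.pack g (GRing.isZmodMorphism.Build X D g gB).
move=> a x y; rewrite -[LHS]/(ga ((x : X) *~ a + y)) raddfD raddfMz.
by rewrite -scaler_int intz.
Qed.

Section Coinduced.
Variables (R : pzRingType) (D : lmodType int).

Fact additive_stable : linear_stable
  [set F : R -> D | forall x y, F (x - y) = F x - F y].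
Proof.
split=> [x y|a u v hu hv x y]; first by rewrite subrr.
change (a *: u (x - y) + v (x - y) = a *: u x + v x - (a *: u y + v y)).
by rewrite hu hv scalerBr opprD addrACA.
Qed.

(** The coinduced module Hom_Z(R, D). Only the group structure is inherited from
    [subm_type], as the scalars are those of [R]. *)
Definition coind : Type := subm_type (mk_submodule additive_stable).
HB.instance Definition _ := GRing.Zmodule.on coind.

Definition coind_fun (F : coind) : R -> D := subm_val F.

Lemma coind_funB F x y : coind_fun F (x - y) = coind_fun F x - coind_fun F y.
Proof. exact: (set_mem (valP F)). Qed.

Definition mk_coind (F : R -> D) (h : forall x y, F (x - y) = F x - F y) : coind :=
  SubmType (mem_set h : F \in subm_pred (mk_submodule additive_stable)).

Lemma coind_ext F G : (forall x, coind_fun F x = coind_fun G x) -> F = G.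
Proof. by move=> h; apply: val_inj; apply/funext. Qed.

Fact coind_scale_subproof (r : R) F x y :
  coind_fun F ((x - y) * r) = coind_fun F (x * r) - coind_fun F (y * r).
Proof. by rewrite mulrBl coind_funB. Qed.

Definition coind_scale r F := mk_coind (coind_scale_subproof r F).

Lemma coind_fun0 F : coind_fun F 0 = 0.
Proof. by rewrite -(subrr 0) coind_funB subrr. Qed.

Lemma coind_funN F x : coind_fun F (- x) = - coind_fun F x.
Proof. by rewrite -sub0r coind_funB coind_fun0 sub0r. Qed.

Lemma coind_funD F x y : coind_fun F (x + y) = coind_fun F x + coind_fun F y.
Proof. by rewrite -[y]opprK coind_funB coind_funN !opprK. Qed.

Fact coind_scaleA a b F : coind_scale a (coind_scale b F) = coind_scale (a * b) F.
Proof. by apply: coind_ext => x; rewrite /coind_fun /= mulrA. Qed.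
Fact coind_scale1 : left_id 1 coind_scale.
Proof. by move=> F; apply: coind_ext => x; rewrite /coind_fun /= mulr1. Qed.
Fact coind_scaleDr : right_distributive coind_scale +%R.
Proof. by move=> a F G; apply: coind_ext. Qed.
Fact coind_scaleDl F : {morph coind_scale^~ F : a b / a + b}.
Proof.
move=> a b; apply: coind_ext => x.
by rewrite {1}/coind_fun /= mulrDr coind_funD.
Qed.

HB.instance Definition _ := GRing.Zmodule_isLmodule.Build R coind
  coind_scaleA coind_scale1 coind_scaleDr coind_scaleDl.

Definition coind_module : lmodType R := coind.

Lemma coind_scaleE r (F : coind_module) x :
  coind_fun (r *: F) x = coind_fun F (x * r).
Proof. by []. Qed.

(** Hom_Z(B, D) -> Hom_R(B, Hom_Z(R, D)), the adjunction that transfers the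
    injectivity of [D]. *)
Section Adjoint.
Variables (B : lmodType R) (h : {linear zmodule B -> D}).

Fact adjoint_additive (b : B) (x y : R) : h ((x - y) *: b) = h (x *: b) - h (y *: b).
Proof. by rewrite scalerBl raddfB. Qed.

Fact adjoint_linear : linear (fun b : B => mk_coind (adjoint_additive b) : coind_module).
Proof.
move=> a u v; apply: coind_ext => x.
change (h (x *: (a *: u + v)) = h ((x * a) *: u) + h (x *: v)).
by rewrite scalerDr scalerA raddfD.
Qed.

Definition adjoint : {linear B -> coind_module} := linear_map adjoint_linear.

Lemma adjointE (b : B) (x : R) : coind_fun (adjoint b) x = h (x *: b).
Proof. by []. Qed.
End Adjoint.

Hypothesis divD : divisible D.

Lemma coind_extend (A B : lmodType R) (i : {linear A -> B})
    (u : {linear A -> coind_module}) :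
  injective i -> exists v : {linear B -> coind_module}, v \o i =1 u.
Proof.
move=> inji.
have lini : linear (i : zmodule A -> zmodule B).
  by apply: additive_int_linear => x y; rewrite raddfB.
have linu : linear ((fun a => coind_fun (u a) 1) : zmodule A -> D).
  by apply: additive_int_linear => x y; rewrite raddfB.
have [h hE] := @baer_extend _ _ (divisible_baer divD) _ _
  (linear_map lini) (linear_map linu) inji.
exists (adjoint h) => a; apply: coind_ext => x /=.
have := hE (x *: a); rewrite /= linearZ => ->.
by rewrite linearZ coind_scaleE mul1r.
Qed.

End Coinduced.

(** Take [D] to be the power of Q/Z over all the group homomorphisms from [M] to
    Q/Z: the evaluation [M -> D] is injective since Q/Z cogenerates, and so is
    its adjoint. *)
Lemma enough_injectives (R : pzRingType) (M : lmodType R) :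
  exists (Q : lmodType R) (j : {linear M -> Q}), injective j /\
    forall (A B : lmodType R) (i : {linear A -> B}) (u : {linear A -> Q}),
    injective i -> exists v : {linear B -> Q}, v \o i =1 u.
Proof.
pose H := {linear zmodule M -> QZ}; pose D : lmodType int := H -> QZ.
have divD : divisible D.
  move=> k d k0; exists (fun h => projT1 (cid (QZ_divisible (d h) k0))).
  by apply/funext => h; rewrite [LHS](projT2 (cid (QZ_divisible (d h) k0))).
have evl : linear ((fun m (h : H) => h m) : zmodule M -> D).
  by move=> a x y; apply/funext => h; rewrite linearP.
exists (coind_module R D), (adjoint (linear_map evl)); split; last first.
  by move=> A B i u; exact: coind_extend.
apply: raddf_inj => m m0; apply: contrapT => /eqP mn0.
have [h /eqP] := @QZ_cogenerator (zmodule M) m mn0; apply.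
have := congr1 (fun F => coind_fun F 1 h) m0.
by rewrite adjointE scale1r.
Qed.

(** * Inclusions, corestrictions and sums of maps on direct sums *)

Section LinearMaps.
Variable R : pzRingType.
Implicit Types X Y : lmodType R.

Fact subm_incl_linear X (N : submodule X) : linear (@subm_val R X N).
Proof. by []. Qed.
Definition subm_incl X (N : submodule X) : {linear subm_type N -> X} :=
  linear_map (@subm_incl_linear X N).

Lemma subm_incl_in X (N : submodule X) (x : subm_type N) : subm_set N (subm_incl N x).
Proof. exact: set_mem (valP x). Qed.

Lemma subm_incl_inj X (N : submodule X) : injective (subm_incl N).
Proof. exact: val_inj. Qed.

Definition mk_sub X (N : submodule X) x (Nx : subm_set N x) : subm_type N :=
  SubmType (mem_set Nx : x \in subm_pred N).

Fact corestrict_linear X Y (f : {linear X -> Y}) (N : submodule Y)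
    (h : forall x, subm_set N (f x)) : linear (fun x => mk_sub (h x)).
Proof. by move=> a x y; apply: val_inj; rewrite /= linearP. Qed.
Definition corestrict X Y (f : {linear X -> Y}) (N : submodule Y)
    (h : forall x, subm_set N (f x)) : {linear X -> subm_type N} :=
  linear_map (corestrict_linear h).

Lemma corestrictE X Y (f : {linear X -> Y}) (N : submodule Y)
  (h : forall x, subm_set N (f x)) x : subm_incl N (corestrict h x) = f x.
Proof. by []. Qed.

Lemma corestrict_inj X Y (f : {linear X -> Y}) (N : submodule Y)
  (h : forall x, subm_set N (f x)) : injective f -> injective (corestrict h).
Proof. by move=> fi x y /(congr1 (subm_incl N)); exact: fi. Qed.

Lemma surj_bij (T U : Type) (f : T -> U) :
  injective f -> (forall y, exists x, f x = y) -> bijective f.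
Proof.
move=> fi fs; exists (fun y => projT1 (cid (fs y))) => [x|y].
  by apply: fi; exact: projT2 (cid (fs (f x))).
exact: projT2 (cid (fs y)).
Qed.

End LinearMaps.

Section Copies.
Variables (R : pzRingType) (M : lmodType R) (I : Type).
Implicit Types (phi : copies M I) (X : lmodType R).

Definition copies_coord phi (i : {classic I}) : M := subm_val phi i.

Arguments copies_coord : simpl never.

Lemma finite_copies_coord phi : finite_set [set i | copies_coord phi i != 0].
Proof. exact: set_mem (valP phi). Qed.

Definition supp phi : set {classic I} := [set i | copies_coord phi i != 0].

Lemma copies_coord_linear i a phi psi :
  copies_coord (a *: phi + psi) i = a *: copies_coord phi i + copies_coord psi i.
Proof. by []. Qed.

Section Sum.
Variables (X : lmodType R) (g : {classic I} -> {linear M -> X}).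

(** The map on the direct sum induced by the family [g]. *)
Definition copies_sum_fun phi : X := \sum_(i \in [set: {classic I}]) g i (copies_coord phi i).

Lemma copies_sum_widen phi (S : set {classic I}) : finite_set S -> supp phi `<=` S ->
  copies_sum_fun phi = \sum_(i <- finmap.enum_fset (fset_set S)) g i (copies_coord phi i).
Proof.
move=> finS sub; rewrite /copies_sum_fun -fsbig_finite //.
apply/esym/fsbig_widen => // i [_ Si] /=.
have [->|c0] := eqVneq (copies_coord phi i) 0; first by rewrite linear0.
by case: Si; apply: sub.
Qed.

Fact copies_sum_linear : linear copies_sum_fun.
Proof.
move=> a phi psi; pose S := supp phi `|` supp psi.
have finS : finite_set S by rewrite finite_setU; split; exact: finite_copies_coord.
rewrite !(@copies_sum_widen _ S) //; first last.
- move=> i; rewrite /supp /= => h; apply/orP; apply: contraNT h.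
  rewrite negb_or !negbK => /andP[/eqP ui /eqP vi].
  by rewrite copies_coord_linear ui vi scaler0 addr0.
- by move=> i; left.
- by move=> i; right.
rewrite scaler_sumr -big_split /=; apply: eq_bigr => i _.
by rewrite copies_coord_linear linearP.
Qed.

Definition copies_sum : {linear copies M I -> X} := linear_map copies_sum_linear.

Lemma copies_sum_in phi (N : submodule X) :
  (forall i, subm_set N (g i (copies_coord phi i))) -> subm_set N (copies_sum phi).
Proof.
move=> h; rewrite [copies_sum phi](@copies_sum_widen phi (supp phi)) //; last first.
  exact: finite_copies_coord.
apply: (big_ind (subm_set N)) => //; first exact: subm_0.
by move=> x y; exact: subm_add.
Qed.

End Sum.

Fact copies_single_subproof i m : finsupp
  ((fun j => if `[< j = i >] then m else 0) : {classic I} -> M).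
Proof.
apply: (sub_finite_set (B := [set i])) => // j /=.
by case: asboolP => // _; rewrite eqxx.
Qed.

Definition copies_single (i : {classic I}) (m : M) : copies M I :=
  @mk_sub _ _ (Submodule (@finsupp_closed R M I)) _ (copies_single_subproof i m).

Lemma copies_coord_single i m j :
  copies_coord (copies_single i m) j = if `[< j = i >] then m else 0.
Proof. by []. Qed.

Lemma copies_coord_ext phi psi : copies_coord phi =1 copies_coord psi -> phi = psi.
Proof. by move=> h; apply: val_inj; apply/funext. Qed.

Fact copies_single_linear i : linear (copies_single i).
Proof.
move=> a u v; apply: copies_coord_ext => j; rewrite copies_coord_linear !copies_coord_single.
by case: asboolP => // _; rewrite scaler0 addr0.
Qed.
Definition copies_single_map i : {linear M -> copies M I} :=
  linear_map (copies_single_linear i).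

Lemma copies_sum_single X (g : {classic I} -> {linear M -> X}) i m :
  copies_sum g (copies_single i m) = g i m.
Proof.
rewrite [LHS](@copies_sum_widen _ g _ [set i]) //; last first.
  by move=> j; rewrite /supp /= copies_coord_single; case: asboolP => // _; rewrite eqxx.
by rewrite -fsbig_finite // fsbig_set1 copies_coord_single; case: asboolP.
Qed.

Lemma copies_span (N : submodule (copies M I)) :
  (forall i m, subm_set N (copies_single i m)) -> forall phi, subm_set N phi.
Proof.
move=> h phi; suff -> : phi = copies_sum copies_single_map phi.
  by apply: copies_sum_in => i; exact: h.
apply: copies_coord_ext => j.
rewrite [copies_sum _ _](@copies_sum_widen _ _ _ (supp phi)) //; last exact: finite_copies_coord.
have -> r : copies_coord (\sum_(i <- r) copies_single_map i (copies_coord phi i)) j =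
            \sum_(i <- r) copies_coord (copies_single i (copies_coord phi i)) j.
  by apply: (big_morph (copies_coord^~ j)).
rewrite -fsbig_finite; last exact: finite_copies_coord.
have [j0|j0] := eqVneq (copies_coord phi j) 0.
  rewrite fsbig1 // => i _; rewrite copies_coord_single.
  by case: asboolP => // <-.
rewrite -(@fsbig_widen _ _ _ _ [set j]) //=.
- by rewrite fsbig_set1 copies_coord_single; case: asboolP.
- by move=> _ ->.
- by move=> i [_ /= ij]; rewrite copies_coord_single; case: asboolP => // ji; case: ij.
Qed.

End Copies.

(** * The category sigma[M] *)

Section Sigma.
Variables (R : pzRingType) (M : lmodType R).
Implicit Types X Y : lmodType R.

Lemma generated_in_sigma X : generated M X -> in_sigma M X.
Proof.
move=> gX; exists X, (subm_full X); split=> //.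
exists (@corestrict _ _ _ idfun (subm_full X) (fun=> I)); apply: surj_bij.
  exact: corestrict_inj.
by move=> y; exists (subm_incl _ y); exact: subm_incl_inj.
Qed.

Lemma iso_im X Y (f : {linear X -> Y}) : injective f -> isomorphic X (subm_type (im f)).
Proof.
move=> fi; have fim x : subm_set (im f) (f x) by exists x.
exists (corestrict fim); apply: surj_bij; first exact: corestrict_inj.
move=> y; have [x _ xy] := subm_incl_in y.
by exists x; apply: subm_incl_inj; rewrite corestrictE.
Qed.

Lemma sigma_embed X : in_sigma M X <->
  exists (G : lmodType R) (f : {linear X -> G}), generated M G /\ injective f.
Proof.
split=> [[G [N [gG [f bf]]]]|[G [f [gG fi]]]].
  by exists G, (subm_incl N \o f); split=> //; apply: inj_comp (@subm_incl_inj _ _ N) (bij_inj bf).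
by exists G, (im f); split=> //; exact: iso_im.
Qed.

Lemma sigma_sub X Y (f : {linear X -> Y}) : injective f -> in_sigma M Y -> in_sigma M X.
Proof.
move=> fi /sigma_embed[G [g [gG gi]]]; apply/sigma_embed.
by exists G, (g \o f); split=> //; exact: inj_comp.
Qed.

Lemma copies_generated (I : Type) : generated M (copies M I).
Proof. by exists I, idfun; apply/seteqP; split=> // x _; exists x. Qed.

Lemma sigma_copies (I : Type) : in_sigma M (copies M I).
Proof. exact/generated_in_sigma/copies_generated. Qed.

Lemma sigma_M : in_sigma M M.
Proof.
apply: (@sigma_sub _ _ (copies_single_map M (tt : {classic unit}))) (sigma_copies unit).
move=> x y /(congr1 (fun phi => copies_coord phi tt)); rewrite !copies_coord_single.
by case: asboolP.
Qed.

Lemma sigma_subM (N : submodule M) : in_sigma M (subm_type N).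
Proof. exact: sigma_sub (@subm_incl_inj _ _ N) sigma_M. Qed.

(** Embed [M] in an injective module [Q] and take the trace of [M] in [Q], the
    sum of the images of all maps [M -> Q]. It is [M]-generated, and it contains
    the image of every map to [Q] from a module in sigma[M], because such a map
    extends to an [M]-generated module. *)
Lemma sigma_injective_exists : exists (E : lmodType R) (j : {linear M -> E}),
  injective j /\ injective_in_sigma M E.
Proof.
have [Q [j [ji injQ]]] := enough_injectives M.
pose p := copies_sum (fun f : {classic {linear M -> Q}} => (f : {linear M -> Q})).
have in_im (f : {linear M -> Q}) m : subm_set (im p) (f m).
  exists (copies_single (f : {classic {linear M -> Q}}) m) => //.
  by rewrite /p copies_sum_single.
have B_im (B : lmodType R) (v : {linear B -> Q}) b : in_sigma M B -> subm_set (im p) (v b).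
  move=> /sigma_embed[G [f [[K [q qs]] fi]]].
  have [w wE] := injQ _ _ f v fi.
  rewrite -wE /=; have [phi _ <-] : range q (f b) by rewrite qs.
  apply: (@copies_span _ _ K (subm_preim (w \o q) (im p)) _ phi) => i m.
  exact: (in_im (w \o q \o copies_single_map M i)).
exists (subm_type (im p)), (corestrict (in_im j)).
split; first exact: corestrict_inj.
split.
  apply: generated_in_sigma; exists {classic {linear M -> Q}}.
  have pim phi : subm_set (im p) (p phi) by exists phi.
  exists (corestrict pim); apply/seteqP; split=> // y _.
  have [x _ xy] := subm_incl_in y.
  by exists x => //; apply: subm_incl_inj; rewrite corestrictE.
move=> A B i u sA sB ii.
have [v vE] := injQ _ _ i (subm_incl _ \o u) ii.
exists (corestrict (fun b => B_im _ v b sB)) => a.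
by apply: subm_incl_inj; exact: vE.
Qed.

End Sigma.

(** * Essential submodules and injective hulls *)

Section Essential.
Variable R : pzRingType.
Implicit Types X Y E H : lmodType R.

(** Essentiality tested on cyclic submodules, a form that passes to unions of
    chains and to preimages. *)
Definition essential X (N : set X) :=
  forall x : X, x != 0 -> exists r : R, r *: x != 0 /\ N (r *: x).

Lemma cyclic_neq0 X (x : X) : x != 0 -> cyclic x <> [set 0] :> set X.
Proof. by move=> /eqP x0 h; apply: x0; have := cyclic_id x; rewrite h. Qed.

Lemma set_neq0 X (A : set X) : A 0 -> A <> [set 0] -> exists2 x, A x & x != 0.
Proof.
move=> A0 hA; apply: contrapT => h; apply/hA/seteqP; split=> [x Ax|_ -> //].
by apply: contrapT => x0; apply: h; exists x => //; exact/eqP.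
Qed.

Lemma essential_monoP X E (i : {linear X -> E}) :
  essential_mono i <-> injective i /\ essential (range i).
Proof.
split=> -[ii ess]; split=> //.
  move=> x x0; have [|] := set_neq0 _ (ess _ (cyclic_neq0 x0)).
    by split; [exists 0; rewrite ?linear0|exact: subm_0].
  by move=> y [iy [r _ ry]] y0; exists r; rewrite ry.
move=> L /subm_neq0[x Lx x0] h.
have [r [/eqP rx0 rx]] := ess x x0; apply: rx0.
suff : (range i `&` L) (r *: x) by rewrite h.
by split=> //; exact: subm_scale.
Qed.

Lemma essential_sub X (A B : set X) : A `<=` B -> essential A -> essential B.
Proof. by move=> AB eA x /eA[r [rx Ar]]; exists r; split=> //; exact: AB. Qed.

Lemma essential_preim X Y (f : {linear X -> Y}) (N : submodule Y) :
  essential N -> essential (subm_preim f N).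
Proof.
move=> eN x x0; have [fx|/eN[r [rfx Nr]]] := eqVneq (f x) 0.
  by exists 1; rewrite scale1r; split=> //=; rewrite fx; exact: subm_0.
exists r; split; last by rewrite /= linearZ.
by apply: contraNneq rfx => rx; rewrite -linearZ rx linear0.
Qed.

(** A map that is injective on an essential submodule is injective, because its
    kernel meets that submodule trivially. *)
Lemma essential_inj X E Y (i : {linear X -> E}) (f : {linear E -> Y}) :
  essential (range i) -> injective (f \o i) -> injective f.
Proof.
move=> ess fi; apply: raddf_inj => e fe; apply: contrapT => /eqP /ess[r [re [x _ ix]]].
suff x0 : x = 0 by move: re; rewrite -ix x0 linear0 eqxx.
by apply: fi; rewrite /= linear0 linear0 ix linearZ /= fe scaler0.
Qed.

Lemma uniform_common_multiple X (x y : X) : uniform X -> x != 0 -> y != 0 ->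
  exists r s : R, r *: x = s *: y /\ r *: x != 0.
Proof.
move=> [_ uX] /cyclic_neq0 x0 /cyclic_neq0 y0.
have [|_ [[r _ <-] [s _ rs]] rx] := set_neq0 _ (uX _ _ x0 y0).
  by split; exact: subm_0.
by exists r, s.
Qed.

End Essential.

Section Hulls.
Variables (R : pzRingType) (M : lmodType R).
Implicit Types X Y E H : lmodType R.

Lemma retract_injective E H (i : {linear H -> E}) (p : {linear E -> H}) :
  injective_in_sigma M E -> injective i -> p \o i =1 id -> injective_in_sigma M H.
Proof.
move=> [sE injE] ii pi; split; first exact: sigma_sub ii sE.
move=> A B k u sA sB ki; have [v vE] := injE A B k (i \o u) sA sB ki.
by exists (p \o v) => a /=; have /= -> := vE a; exact: pi.
Qed.

(** Let [C] be a maximal essential extension of [X] in [E] and [D] maximal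
    independent of [C]. The projection [C + D -> C] extends to [psi : E -> E], and
    by maximality of [D] its image is an essential extension of [C], hence equals
    [C]. So [C] is a retract of [E]. *)
Lemma hull_in_injective X E (j : {linear X -> E}) :
  injective_in_sigma M E -> injective j ->
  exists (H : lmodType R) (i : {linear X -> H}), injective_hull M i.
Proof.
move=> [sE injE] ji.
pose ext (C : submodule E) := range j `<=` C /\
  forall c, subm_set C c -> c != 0 -> exists r, r *: c != 0 /\ range j (r *: c).
have [||C [jC eC] maxC] := @max_submodule _ _ ext (im j).
- by split=> [x|c jc c0] //; exists 1; rewrite scale1r.
- move=> F [N FN] FP _ L LE; rewrite /ext LE; split=> [x jx|c [K FK Kc]].
    by exists N => //; exact: (FP _ FN).1.
  exact: (FP _ FK).2.
have [||D CD maxD] := @max_submodule _ _ (fun D => D `&` C `<=` [set 0]) (subm0 E).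
- by move=> x [].
- by move=> F _ FP _ L -> x [[N FN Nx] Cx]; exact: (FP _ FN).
(* C + D is represented by the product, embedded in E by addition *)
have addl : linear (fun p : (subm_type C * subm_type D)%type => subm_incl C p.1 + subm_incl D p.2).
  by move=> a p q; rewrite /= scalerDr addrACA.
have prl : linear (fun p : (subm_type C * subm_type D)%type => subm_incl C p.1) by [].
have addi : injective (linear_map addl).
  apply: raddf_inj => -[c d] /= cd0.
  have cd : subm_incl C c = - subm_incl D d by apply/eqP; rewrite -addr_eq0; apply/eqP.
  have c0 : subm_incl C c = 0.
    by apply: CD; split; [rewrite cd; apply: subm_opp|]; exact: subm_incl_in.
  have d0 : subm_incl D d = 0 by apply/eqP; rewrite -oppr_eq0 -cd c0.
  by congr pair; apply: subm_incl_inj.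
have [psi psiE] := injE _ _ _ (linear_map prl) (sigma_sub addi sE) sE addi.
have psiC c : subm_set C c -> psi c = c.
  by move=> Cc; have /= := psiE (mk_sub Cc, 0); rewrite addr0.
have psiD d : subm_set D d -> psi d = 0.
  by move=> Dd; have /= := psiE (0, mk_sub Dd); rewrite add0r.
have imC y : subm_set C (psi y).
  apply: (maxC (im psi)); last by exists y.
    split=> [x jx|_ [z _ <-] pz0]; first by exists x => //; exact/psiC/jC.
    pose D1 := subm_sum D (cyclic z).
    have [r [rz Cr]] : exists r, r *: psi z != 0 /\ subm_set C (r *: psi z).
      apply: contrapT => h.
      suff cap : D1 `&` C `<=` [set 0].
        move: pz0; rewrite psiD ?eqxx //; apply: (maxD D1 cap).
          by move=> d Dd; exists d, 0; rewrite addr0; split=> //; exact: subm_0.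
        by exists 0, z; rewrite add0r; split=> //; [exact: subm_0|exact: cyclic_id].
      move=> _ [[d [_ [Dd [r _ <-] ->]]] Cdr].
      have rz : r *: psi z = d + r *: z.
        by rewrite -(psiC _ Cdr) linearD linearZ /= (psiD d) // add0r.
      apply: contrapT => /eqP n0; apply: h; exists r.
      by rewrite rz; split.
    have [s [srz jsrz]] := eC _ Cr rz.
    by exists (s * r); rewrite -scalerA.
  by move=> c Cc; exists c => //; exact: psiC.
have jC' x : subm_set C (j x) by apply: jC; exists x.
exists (subm_type C), (corestrict jC'); split.
  apply: (@retract_injective E (subm_type C) (subm_incl C) (corestrict imC)) => //.
    exact: subm_incl_inj.
  by move=> c; apply: subm_incl_inj; exact: (psiC _ (subm_incl_in c)).
apply/essential_monoP; split; first exact: corestrict_inj.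
move=> c c0; have [|r [rc [x _ jx]]] := eC (subm_incl C c) (subm_incl_in c).
  by apply: contraNneq c0 => c0; apply/eqP/subm_incl_inj.
exists r; split; first by apply: contraNneq rc => rc; rewrite -linearZ rc.
by exists x => //; apply: subm_incl_inj; rewrite corestrictE jx.
Qed.

Lemma hull_exists X (j : {linear X -> M}) : injective j ->
  exists (H : lmodType R) (i : {linear X -> H}), injective_hull M i.
Proof.
move=> ji; have [E [k [ki injE]]] := sigma_injective_exists M.
by apply: (@hull_in_injective X E (k \o j)) => //; exact: inj_comp.
Qed.

(** Extending the identity of [X] along [j] gives [v : E -> X], and [E] is the direct
    sum of [im j] and [ker v]. *)
Lemma injective_summand X E (j : {linear X -> E}) :
  injective_in_sigma M X -> nonzero_module X -> indecomposable E ->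
  in_sigma M E -> injective j -> bijective j.
Proof.
move=> [sX injX] [x x0] [_ indE] sE ji.
have [v vE] := injX _ _ j idfun sX sE ji.
have [|j0|v0] := indE (im j) (ker v).
- split; last first.
    move=> e; exists (j (v e)), (e - j (v e)); split; last by rewrite addrC subrK.
      by exists (v e).
    by rewrite /= linearB; have /= -> := vE (v e); rewrite subrr.
  apply/seteqP; split=> [_ [[y _ <-]]|_ ->]; last by split; exact: subm_0.
  by rewrite /=; have /= -> := vE y => ->; rewrite linear0.
- have : subm_set (im j) (j x) by exists x.
  by rewrite j0 /= => jx; case/eqP: x0; apply: ji; rewrite jx linear0.
- apply: surj_bij => // e; exists (v e); apply/eqP; rewrite eq_sym -subr_eq0; apply/eqP.
  suff : subm_set (ker v) (e - j (v e)) by rewrite v0.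
  by rewrite /= linearB; have /= -> := vE (v e); rewrite subrr.
Qed.

Lemma uniform_hull_indecomposable X E (i : {linear X -> E}) :
  uniform X -> injective i -> essential (range i) -> indecomposable E.
Proof.
move=> uX ii ess; split.
  have [[x x0] _] := uX; exists (i x); apply: contraNneq x0 => ix.
  by apply/eqP/ii; rewrite ix linear0.
move=> A B [AB0 _]; apply: contrapT => /not_orP[/subm_neq0[a Aa a0] /subm_neq0[b Bb b0]].
have [r [ra [x _ ix]]] := ess a a0; have [s [sb [y _ iy]]] := ess b b0.
have nz z c : i z = c -> c != 0 -> z != 0.
  by move=> <-; apply: contraNneq => ->; rewrite linear0.
have [p [q [pq px]]] := uniform_common_multiple uX (nz _ _ ix ra) (nz _ _ iy sb).
move/eqP: px; apply; apply: ii; rewrite linear0.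
suff : (A `&` B) (i (p *: x)) by rewrite AB0.
split; first by rewrite linearZ /= ix; do 2!apply: subm_scale.
by rewrite pq linearZ /= iy; do 2!apply: subm_scale.
Qed.

(** The hull of [X] embeds in [E] as a direct summand, so it is all of [E]. *)
Lemma indecomposable_essential X E (j : {linear X -> M}) (i : {linear X -> E}) :
  nonzero_module X -> injective j -> injective i ->
  indecomposable E -> injective_in_sigma M E -> essential (range i).
Proof.
move=> [x x0] ji ii indE [sE injE].
have [H [k [injH /essential_monoP[ki ess]]]] := hull_exists ji.
have [f fE] := injE _ _ k i (sigma_sub ji (sigma_M M)) injH.1 ki.
have fi : injective f.
  by apply: (essential_inj ess) => a b; rewrite !fE; exact: ii.
have kx0 : k x != 0.
  by apply: contraNneq x0 => kx; apply/eqP/ki; rewrite kx linear0.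
have nH : nonzero_module H by exists (k x).
have [g gf fg] := injective_summand injH nH indE sE fi.
move=> e e0; have ge0 : g e != 0.
  by apply: contraNneq e0 => ge; rewrite -(fg e) ge linear0.
have [r [rge [y _ ky]]] := ess _ ge0; exists r; split.
  by apply: contraNneq rge => re; apply/eqP/fi; rewrite linearZ /= fg re linear0.
by exists y => //; have /= <- := fE y; rewrite ky linearZ /= fg.
Qed.

End Hulls.

(** * The product of submodules *)

Section Products.
Variables (R : pzRingType) (M : lmodType R).
Implicit Types K L N U V : submodule M.

(** Maps [M -> L] are handled as endomorphisms of [M] with values in [L]. *)
Definition into (f : {linear M -> M}) L := forall x, subm_set L (f x).

Fact subm_span_stable (A : set M) :
  linear_stable [set x | forall N, A `<=` N -> subm_set N x].
Proof.
split=> [N _|a u v hu hv N AN]; first exact: subm_0.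
by apply: subm_lin; [exact: hu | exact: hv].
Qed.
Definition subm_span (A : set M) := mk_submodule (@subm_span_stable A).

(** The product K_M L, encoded as a smallest submodule because it is used through
    its inclusions in other submodules ([mprodP]) rather than through its elements.
    Below, KL stands for [mprod K L] and M for the submodule [subm_full M]. *)
Definition mprod K L := subm_span [set x | exists f k, [/\ into f L, subm_set K k & x = f k]].

Lemma mprodP K L N :
  mprod K L `<=` N <-> forall f k, into f L -> subm_set K k -> subm_set N (f k).
Proof.
split=> [h f k fL Kk|h x]; last by apply=> _ [f [k [fL Kk ->]]]; exact: h.
by apply: h => N' sub; apply: sub; exists f, k.
Qed.

Lemma mprod_gen K L f k : into f L -> subm_set K k -> subm_set (mprod K L) (f k).
Proof. exact: ((mprodP K L (mprod K L)).1 (fun x h => h)). Qed.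

Lemma subm_prodE K L N : subm_prod K L `<=` N <-> mprod K L `<=` N.
Proof.
split=> [h|/mprodP h x [n [f [k [Kk ->]]]]].
  apply/mprodP => f k fL Kk; apply: h.
  exists 1, (fun=> corestrict fL), (fun=> k); split=> //.
  by rewrite big_ord1.
apply: (big_ind (subm_set N)) => [|x1 y|i _]; [exact: subm_0|exact: subm_add|].
by apply: (h (subm_incl L \o f i)) => // y; exact: subm_incl_in.
Qed.

Lemma subset_antisym K L : K `<=` L -> L `<=` K -> K = L.
Proof. by move=> KL LK; apply/submodule_ext/seteqP. Qed.

Lemma subm0_sub K : subm0 M `<=` K.
Proof. by move=> _ ->; exact: subm_0. Qed.

Lemma mprod_subr K L : mprod K L `<=` L.
Proof. by apply/mprodP. Qed.

Lemma mprod_mono K K' L L' : K `<=` K' -> L `<=` L' -> mprod K L `<=` mprod K' L'.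
Proof.
move=> KK LL; apply/mprodP => f k fL Kk.
by apply: mprod_gen; [move=> x; exact/LL | exact: KK].
Qed.

Lemma mprod0l L : mprod (subm0 M) L = subm0 M.
Proof.
apply: subset_antisym; last exact: subm0_sub.
by apply/mprodP => f _ _ ->; exact: linear0.
Qed.

Lemma mprod0r K : mprod K (subm0 M) = subm0 M.
Proof. by apply: subset_antisym; [exact: mprod_subr | exact: subm0_sub]. Qed.

Lemma mprod_full K : K `<=` mprod K (subm_full M).
Proof. by move=> k Kk; apply: (@mprod_gen K (subm_full M) idfun). Qed.

Lemma fully_invariant_mprod K L : fully_invariant K -> mprod K L `<=` K.
Proof. by move=> fK; apply/mprodP => f k _ Kk; apply: (fK f); exists k. Qed.

Lemma mprod_full_invariant K : fully_invariant (mprod K (subm_full M)).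
Proof.
move=> f _ [x Kx <-]; move: x Kx.
apply: (mprodP K (subm_full M) (subm_preim f (mprod K (subm_full M)))).2 => g k _ Kk.
exact: (@mprod_gen K (subm_full M) (f \o g)).
Qed.

Lemma fully_invariant_cap K L :
  fully_invariant K -> fully_invariant L -> fully_invariant (subm_cap K L).
Proof.
by move=> fK fL f _ [x [Kx Lx] <-]; split; [apply: (fK f)|apply: (fL f)]; exists x.
Qed.

Lemma prime_mprod P K L : prime_in P -> fully_invariant K -> fully_invariant L ->
  mprod K L `<=` P -> K `<=` P \/ L `<=` P.
Proof. by move=> [_ _ primeP] fK fL KL; apply: primeP => //; exact/subm_prodE. Qed.

Section Projective.
Hypothesis proj_M : projective_in_sigma M M.

Lemma projective_lift (B X : lmodType R) (p : {linear B -> X}) (f : {linear M -> X}) :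
  in_sigma M B -> in_sigma M X -> (forall m, range p (f m)) ->
  exists v : {linear M -> B}, p \o v =1 f.
Proof.
move=> sB sX fp; have pim b : subm_set (im p) (p b) by exists b.
have [] := proj_M (f := subm_incl (ker p)) (g := corestrict pim).
- exact: sigma_sub (@subm_incl_inj _ _ _) sB.
- by [].
- exact: sigma_sub (@subm_incl_inj _ _ _) sX.
- split; first exact: subm_incl_inj.
    apply/seteqP; split=> [_ [k _ <-]|b pb] /=.
      by apply: subm_incl_inj; rewrite corestrictE linear0; exact: (subm_incl_in k).
    have kb : subm_set (ker p) b.
      by rewrite /= -(corestrictE pim) pb linear0.
    by exists (mk_sub kb).
  apply/seteqP; split=> // y _; have [b _ by_] := subm_incl_in y.
  by exists b => //; apply: subm_incl_inj; rewrite corestrictE.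
move=> _ _ lift; have fim m : subm_set (im p) (f m) by exact: fp.
have [v vE] := lift (corestrict fim); exists v => m.
by have /= /(congr1 (subm_incl _)) := vE m.
Qed.

(** [mprod L U] is the sum of the images [g L], so [f] lifts along a surjection
    onto it from a direct sum of copies of [L] indexed by the [g]; the
    coordinates of the lift are maps [h : M -> L], and [f k] is a sum of elements
    [g (h k)]. *)
Lemma mprod_factor L U N f k : into f (mprod L U) ->
  (forall g h, into g U -> into h L -> subm_set N (g (h k))) -> subm_set N (f k).
Proof.
move=> fLU gh; pose G := {g : {linear M -> M} | into g U}.
pose p := copies_sum (fun g : {classic G} => sval (g : G)).
have Bst : linear_stable [set phi : copies M G | forall g, subm_set L (copies_coord phi g)].
  split=> [g|a u v hu hv g]; first exact: subm_0.
  by rewrite copies_coord_linear; exact: subm_lin.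
pose B := mk_submodule Bst.
have [|||v vE] := @projective_lift (subm_type B) M (p \o subm_incl B) f.
- exact: sigma_sub (@subm_incl_inj _ _ _) (sigma_copies M G).
- exact: sigma_M.
- move=> m; apply: ((mprodP L U (im (p \o subm_incl B))).2 _ _ (fLU m)) => g l gU Ll.
  pose gg : {classic G} := exist _ g gU.
  have Bs : subm_set B (copies_single gg l).
    move=> g'; rewrite copies_coord_single; case: asboolP => // _; exact: subm_0.
  by exists (mk_sub Bs) => //; exact: (copies_sum_single (fun g : {classic G} => sval (g : G)) gg l).
rewrite -vE; apply: (@copies_sum_in _ _ _ _ _ (subm_incl B (v k))) => g.
have hl : linear (fun m => copies_coord (subm_incl B (v m)) g).
  by move=> a x y; rewrite !linearP copies_coord_linear.
apply: (gh (sval g) (linear_map hl) (svalP (g : G))).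
by move=> x; exact: (subm_incl_in (v x)).
Qed.

Lemma mprodA K L U : mprod (mprod K L) U = mprod K (mprod L U).
Proof.
apply: subset_antisym; apply/mprodP => f x fU.
  move: x; apply: (mprodP K L (subm_preim f (mprod K (mprod L U)))).2 => g k gL Kk.
  by apply: (@mprod_gen K (mprod L U) (f \o g)) => // y; exact: (mprod_gen fU (gL y)).
move=> Kk; apply: (mprod_factor fU) => g h gU hL.
by apply: mprod_gen => //; exact: mprod_gen.
Qed.

Section Semiprime.
Hypothesis semiprime_M : semiprime_module M.

(** [KM] is the fully invariant submodule generated by [K], and (KM)(KM) = K(MK)M
    is contained in (KK)M. *)
Lemma semiprime_mprod K : mprod K K = subm0 M -> K = subm0 M.
Proof.
move=> KK; have [_ _ semi] := semiprime_M.
suff K0 : mprod K (subm_full M) `<=` subm0 M.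
  by apply: subset_antisym; [exact: subset_trans (@mprod_full K) K0 | exact: subm0_sub].
apply: semi; first exact: mprod_full_invariant.
apply/subm_prodE; set T := subm_full M.
have -> : mprod (mprod K T) (mprod K T) = mprod (mprod K (mprod T K)) T by rewrite !mprodA.
rewrite -(mprod0l T) -KK.
by apply: mprod_mono => //; apply: mprod_mono => //; exact: mprod_subr.
Qed.

(** (LK)(LK) = L(KL)K. *)
Lemma mprod_sym K L : mprod K L = subm0 M -> mprod L K = subm0 M.
Proof. by move=> KL; apply: semiprime_mprod; rewrite mprodA -(mprodA K) KL mprod0l mprod0r. Qed.

Lemma mprod_full0 K : mprod (subm_full M) K = subm0 M -> K = subm0 M.
Proof.
move=> h; apply: semiprime_mprod; apply: subset_antisym; last exact: subm0_sub.
by rewrite -h; exact: mprod_mono.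
Qed.

Lemma exists_into_neq0 K : K <> subm0 M ->
  exists f k, [/\ into f K, subm_set K k & f k != 0].
Proof.
move=> K0; apply: contrapT => h; apply/K0/semiprime_mprod/subset_antisym.
  apply/mprodP => f k fK Kk; apply: contrapT => /eqP fk; apply: h.
  by exists f, k.
exact: subm0_sub.
Qed.

End Semiprime.
End Projective.
End Products.

(** * Annihilators and minimal primes *)

Lemma ACC_max (T : Type) (F : set (set T)) (P : set T -> Prop) :
  ACC F -> (forall A, P A -> F A) -> (exists A, P A) ->
  exists2 A, P A & forall B, P B -> A `<=` B -> B `<=` A.
Proof.
move=> accF PF [A0 PA0]; apply: contrapT => nomax.
have step (a : {A | P A}) : exists b : {A | P A}, sval a `<=` sval b /\ ~ sval b `<=` sval a.
  apply: contrapT => h; apply: nomax; exists (sval a); first exact: svalP.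
  by move=> B PB aB; apply: contrapT => Ba; apply: h; exists (exist _ B PB).
pose next a := projT1 (cid (step a)).
pose s n := iter n next (exist _ A0 PA0).
have sS n : sval (s n) `<=` sval (s n.+1) /\ ~ sval (s n.+1) `<=` sval (s n).
  exact: projT2 (cid (step (s n))).
have [|n nE] := accF (fun n => sval (s n)) (fun n => PF _ (svalP (s n))).
  by move=> n; exact: (sS n).1.
by apply: (sS n).2; rewrite (nE n.+1 (leqnSn n)).
Qed.

Section Annihilators.
Variables (R : pzRingType) (M : lmodType R).
Implicit Types (K L N U V : submodule M) (X Y : lmodType R).

Fact ann_stable X : linear_stable [set m | forall f : {linear M -> X}, f m = 0].
Proof.
split=> [f|a u v hu hv f]; first exact: linear0.
by rewrite linearP hu hv scaler0 addr0.
Qed.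
(** The annihilator Ann_M(X). *)
Definition ann X := mk_submodule (@ann_stable X).

Lemma ann_inj X Y (e : {linear X -> Y}) : injective e -> ann Y `<=` ann X.
Proof. by move=> ei m h f; apply: ei; rewrite linear0; exact: (h (e \o f)). Qed.

Lemma fully_invariant_ann X : fully_invariant (ann X).
Proof. by move=> f _ [m h <-] g; exact: (h (g \o f)). Qed.

Lemma annP L m : subm_set (ann (subm_type L)) m <-> forall f, into f L -> f m = 0.
Proof.
split=> [h f fL|h f].
  by have /(congr1 (subm_incl L)) := h (corestrict fL); rewrite linear0.
apply: subm_incl_inj; rewrite linear0; apply: (h (subm_incl L \o f)) => x.
exact: subm_incl_in.
Qed.

(** [ann L] is the largest submodule whose product with [L] vanishes. *)
Lemma ann_mprod K L : K `<=` ann (subm_type L) <-> mprod K L = subm0 M.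
Proof.
split=> [h|h k Kk].
  apply: subset_antisym; last exact: subm0_sub.
  by apply/mprodP => f k fL Kk; have /annP := h k Kk; exact.
apply/annP => f fL; suff : subm_set (subm0 M) (f k) by [].
by rewrite -h; exact: mprod_gen.
Qed.

Lemma ann_annihilator L : annihilators M (ann (subm_type L)).
Proof.
exists [set f | into f L]; apply/seteqP; split=> [m /annP h f|m h]; first exact: h.
by apply/annP => f; exact: h.
Qed.

Lemma ann_anti K L : K `<=` L -> ann (subm_type L) `<=` ann (subm_type K).
Proof. by move=> KL m /annP h; apply/annP => f fK; apply: h => x; exact/KL. Qed.

Hypothesis proj_M : projective_in_sigma M M.
Hypothesis semiprime_M : semiprime_module M.
Hypothesis acc_M : ACC (annihilators M).

(** Choose a nonzero [h] with essential kernel, and with that kernel maximal.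
    Each [h \o s \o h] has a kernel larger than that of [h], since the essential
    kernel of [h \o s] meets the image of [h]. Hence all [h \o s \o h] vanish. As
    every map from [M] to [im h] is some [h \o s], the product of [im h] with
    itself is zero, and [h = 0] by semiprimeness. *)
Lemma essential_kernel_eq0 (g : {linear M -> M}) : essential (ker g) -> forall x, g x = 0.
Proof.
move=> eg x; apply: contrapT => gx.
pose P A := exists g : {linear M -> M},
  [/\ essential (ker g), exists x, g x != 0 & A = ker g :> set M].
have [||_ [{eg gx}h [eh [y hy] ->]] maxh] := ACC_max (P := P) acc_M.
- move=> _ [h [_ _ ->]]; exists [set h].
  by apply/seteqP; split=> [z hz _ ->|z hz] //; exact: hz.
- by exists (ker g), g; split=> //; exists x; exact/eqP.
have hsh (s : {linear M -> M}) z : h (s (h z)) = 0.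
  apply: contrapT => /eqP hshz; pose k : {linear M -> M} := h \o s \o h.
  have hk : ker h `<=` ker k by move=> w; rewrite /= => ->; rewrite !linear0.
  have kh : ker k `<=` ker h.
    by apply: maxh => //; exists k; split=> //; [exact: essential_sub hk eh|exists z].
  have [r [rhy hsr]] := essential_preim s eh hy.
  move/eqP: rhy; apply; rewrite -linearZ; apply: kh.
  by rewrite /= linearZ.
have im0 : im h = subm0 M.
  apply: (semiprime_mprod proj_M semiprime_M); apply: subset_antisym; last exact: subm0_sub.
  apply/mprodP => f _ fh [z _ <-].
  have [s sE] := projective_lift proj_M (sigma_M M) (sigma_M M) fh.
  by rewrite -sE; exact: hsh.
have : subm_set (im h) (h y) by exists y.
by rewrite im0 => /= /eqP; rewrite (negPf hy).
Qed.

Section Uniform.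
Variable U : submodule M.
Hypothesis uU : uniform (subm_type U).

Lemma uniform_neq0 : U <> subm0 M.
Proof.
move=> U0; have [[x /eqP x0] _] := uU; apply/x0/subm_incl_inj; rewrite linear0.
have US : U `<=` subm0 M by rewrite U0.
exact: US (subm_incl_in x).
Qed.

Lemma uniform_mprod_neq0 : mprod U U <> subm0 M.
Proof. by move=> /(semiprime_mprod proj_M semiprime_M); exact: uniform_neq0. Qed.

(** [V] is essential in [U] because [U] is uniform. *)
Lemma uniform_preim_essential V (s : {linear M -> M}) :
  V <> subm0 M -> V `<=` U -> into s U -> essential (subm_preim s V).
Proof.
move=> V0 VU sU x x0.
have [sx|sx] := eqVneq (s x) 0.
  by exists 1; rewrite scale1r; split=> //=; rewrite sx; exact: subm_0.
have [v Vv v0] : exists2 v, subm_set V v & v != 0.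
  by apply: subm_neq0 => h; exact/V0/submodule_ext.
have nz w (Uw : subm_set U w) : w != 0 -> mk_sub Uw != 0.
  by apply: contraNneq => /(congr1 (subm_incl U)); rewrite linear0 /= => ->.
have [r [t [rt r0]]] := uniform_common_multiple uU (nz _ (sU x) sx) (nz _ (VU v Vv) v0).
exists r; split.
  apply: contraNneq r0 => rx; apply/eqP/subm_incl_inj.
  by rewrite linear0 linearZ /= -linearZ rx linear0.
rewrite /= linearZ; have /= -> := congr1 (subm_incl U) rt.
exact: subm_scale.
Qed.

(** Let [K = ann V]. By symmetry the maps [h : M -> K] kill [V], which is
    essential in [U]; so [h \o s] has essential kernel for each [s : M -> U], hence
    vanishes. Thus (MU)K = 0, and K(MU) = 0 by symmetry. As K is contained in KM,
    associativity gives KU = 0. *)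
Lemma ann_uniform V : V <> subm0 M -> V `<=` U ->
  ann (subm_type V) = ann (subm_type U).
Proof.
move=> V0 VU; apply: subset_antisym; last exact: ann_anti.
set K := ann _.
have VK : mprod V K = subm0 M.
  by apply: (mprod_sym proj_M semiprime_M); apply/ann_mprod.
have UK : mprod (mprod (subm_full M) U) K = subm0 M.
  apply: subset_antisym; last exact: subm0_sub.
  apply/mprodP => h x hK; move: x.
  apply: (mprodP (subm_full M) U (ker h)).2 => s x sU _.
  apply: (essential_kernel_eq0 (g := h \o s)).
  apply: essential_sub (uniform_preim_essential V0 VU sU) => y /= Vsy.
  suff : subm_set (subm0 M) (h (s y)) by [].
  by rewrite -VK; exact: mprod_gen.
apply/ann_mprod; apply: subset_antisym; last exact: subm0_sub.
rewrite -(mprod_sym proj_M semiprime_M UK) -(mprodA proj_M).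
by apply: mprod_mono => //; exact: mprod_full.
Qed.

(** If (KL)U = 0 then K kills LU. Either LU = 0, or LU is a nonzero submodule of
    [U], with the same annihilator. *)
Lemma prime_ann : prime_in (ann (subm_type U)).
Proof.
split; first exact: fully_invariant_ann.
  move=> annT; apply: uniform_mprod_neq0; apply/ann_mprod; rewrite annT.
  by [].
move=> K L _ _ /subm_prodE /ann_mprod; rewrite (mprodA proj_M) => KLU.
have [LU|LU] := pselect (mprod L U = subm0 M); first by right; exact/ann_mprod.
by left; rewrite -(ann_uniform LU (@mprod_subr _ _ L U)); exact/ann_mprod.
Qed.

Lemma ann_sub_prime P : prime_in P -> ~ U `<=` P -> ann (subm_type U) `<=` P.
Proof.
move=> primeP UP.
have [] // := prime_mprod primeP (@fully_invariant_ann (subm_type U)) (@mprod_full_invariant _ _ U).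
  rewrite -(mprodA proj_M) (_ : mprod _ U = subm0 M) ?mprod0l; first exact: subm0_sub.
  exact/ann_mprod.
by move=> h; case: UP; exact: subset_trans (@mprod_full _ _ U) h.
Qed.

Lemma SpecMin_ann : SpecMin M (ann (subm_type U)).
Proof.
split=> [|Q primeQ Qann]; first exact: prime_ann.
apply: subset_antisym => //; apply: ann_sub_prime => // UQ.
apply: uniform_mprod_neq0; apply/ann_mprod; exact: subset_trans Qann.
Qed.

End Uniform.

Hypothesis unif_M : forall N : submodule M, N <> [set 0] :> set M ->
  exists U : submodule M, U `<=` N /\ uniform (subm_type U).

(** Call [K] good if it is fully invariant and, when it lies in [P], some [ann U]
    lies in [P]. The whole module is good, and [K] intersected with [ann U] is good
    when [K] is. Choose a good [K] with [ann K] maximal. If [K] is not zero it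
    contains some uniform [U]; intersecting [K] with [ann U] shows, by maximality,
    that [U] lies in [ann K], so UU = 0, which is absurd. So [0] is good. *)
Lemma SpecMin_is_ann P : SpecMin M P ->
  exists2 U : submodule M, uniform (subm_type U) & P = ann (subm_type U).
Proof.
move=> [primeP minP].
suff [U uU annP] : exists2 U : submodule M, uniform (subm_type U) & ann (subm_type U) `<=` P.
  by exists U => //; apply/esym/minP => //; exact: prime_ann.
pose good K := fully_invariant K /\ (K `<=` P ->
  exists2 U : submodule M, uniform (subm_type U) & ann (subm_type U) `<=` P).
pose F A := exists2 K, good K & A = ann (subm_type K) :> set M.
have [||_ [K [fK goodK] ->] maxK] := ACC_max (P := F) acc_M.
- by move=> _ [K _ ->]; exact: ann_annihilator.
- exists (ann (subm_type (subm_full M))), (subm_full M) => //; split=> // MP.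
  by have [_ PT _] := primeP; case: PT; apply/seteqP.
suff K0 : K = subm0 M by apply: goodK; rewrite K0; exact: subm0_sub.
apply: contrapT => K0; have [|U [UK uU]] := unif_M (N := K).
  by move=> h; exact/K0/submodule_ext.
pose K' := subm_cap K (ann (subm_type U)).
have gK' : good K'.
  have fA := @fully_invariant_ann (subm_type U).
  split=> [|K'P]; first exact: fully_invariant_cap.
  have [|//|AP] := prime_mprod primeP fK fA; last by exists U.
    apply: subset_trans K'P => x Kx; split; last exact: mprod_subr Kx.
    exact: fully_invariant_mprod Kx.
have annK' : ann (subm_type K') `<=` ann (subm_type K).
  by apply: maxK; [exists K' | apply: ann_anti => x []].
apply: (uniform_mprod_neq0 uU); apply: subset_antisym; last exact: subm0_sub.
have UK' : U `<=` ann (subm_type K').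
  by apply/ann_mprod/(mprod_sym proj_M semiprime_M)/ann_mprod => x [].
have /ann_mprod <- := subset_trans UK' annK'.
exact: mprod_mono.
Qed.

(** [MV] does not kill [U], since otherwise it would kill [V]; so some composite of
    [s : M -> V] and [f : M -> U] is nonzero. If [f] were not injective on [V], its
    kernel there would be essential and [f \o s] would vanish. *)
Lemma ann_eq_embed U V : uniform (subm_type U) -> uniform (subm_type V) ->
  ann (subm_type U) = ann (subm_type V) ->
  exists e : {linear subm_type V -> subm_type U}, injective e.
Proof.
move=> uU uV UV.
have [s [f [sV fU fs]]] : exists (s f : {linear M -> M}),
    [/\ into s V, into f U & exists x, f (s x) != 0].
  apply: contrapT => h.
  have MVU : mprod (mprod (subm_full M) V) U = subm0 M.
    apply: subset_antisym; last exact: subm0_sub.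
    apply/mprodP => f x fU; move: x.
    apply: (mprodP (subm_full M) V (ker f)).2 => s x sV _.
    apply: contrapT => /eqP fsx; apply: h; exists s, f; split=> //.
    by exists x.
  move/ann_mprod: MVU; rewrite UV => /ann_mprod; rewrite (mprodA proj_M).
  by move/(mprod_full0 proj_M semiprime_M); exact: (uniform_mprod_neq0 uV).
exists (@corestrict _ _ _ (f \o subm_incl V) U (fun x => fU (subm_incl V x))).
apply: raddf_inj => v /(congr1 (subm_incl U)); rewrite linear0 corestrictE => fv.
apply: contrapT => v0; have [x] := fs; apply/negP; rewrite negbK; apply/eqP.
apply: (essential_kernel_eq0 (g := f \o s)).
pose C := cyclic (subm_incl V v).
have CV : C `<=` V by exact: cyclic_sub (subm_incl_in v).
apply: essential_sub (uniform_preim_essential uV _ CV sV).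
  move=> y [r _ sy] /=; rewrite -sy linearZ /=.
  by rewrite -[f _]/((f \o subm_incl V) v) fv scaler0.
move=> C0; apply: v0; apply: subm_incl_inj; rewrite linear0.
by have := cyclic_id (subm_incl V v); rewrite -/C C0.
Qed.

End Annihilators.

(** * Indecomposable torsion free injectives *)

Section Correspondence.
Variables (R : pzRingType) (M : lmodType R).
Implicit Types (U V : submodule M) (X Y Z : lmodType R).

Lemma factor_inj X Y Z (i : {linear Y -> X}) (t : {linear Z -> X}) :
  injective i -> (forall z, range i (t z)) ->
  exists s : {linear Z -> Y}, i \o s =1 t.
Proof.
move=> ii ti.
pose s z := projT1 (cid2 (ti z)).
have sE z : i (s z) = t z by rewrite /s; case: cid2.
have ls : linear s by move=> a x y; apply: ii; rewrite linearP !sE linearP.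
by exists (linear_map ls).
Qed.

Hypothesis proj_M : projective_in_sigma M M.
Hypothesis semiprime_M : semiprime_module M.
Hypothesis acc_M : ACC (annihilators M).

Lemma ann_embed V Y (s : {linear Y -> subm_type V}) :
  uniform (subm_type V) -> nonzero_module Y -> injective s ->
  ann M Y = ann M (subm_type V).
Proof.
move=> uV [y y0] si; pose t : {linear Y -> M} := subm_incl V \o s.
have ti : injective t := inj_comp (@subm_incl_inj _ _ V) si.
have WV : im t `<=` V by move=> _ [z _ <-]; exact: subm_incl_in.
rewrite -(ann_uniform proj_M semiprime_M acc_M uV _ WV); last first.
  move=> W0; have : subm_set (im t) (t y) by exists y.
  by rewrite W0 => ty; case/eqP: y0; apply: ti; rewrite linear0; exact: ty.
have [u uE] := factor_inj ti (@subm_incl_in _ _ (im t)).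
have tW z : subm_set (im t) (t z) by exists z.
apply: subset_antisym; last exact: ann_inj (corestrict_inj (h := tW) ti).
apply: (@ann_inj _ _ _ _ u) => a b ab; apply: subm_incl_inj.
by rewrite -!uE /= ab.
Qed.

Notation class := (indec_torsion_free_injective M (chi M)).

(** [V] is essential in [X], so the images of [V] and [V'] share a nonzero cyclic
    submodule. *)
Lemma class_ann X V V' (e : {linear subm_type V -> X}) (e' : {linear subm_type V' -> X}) :
  class X -> uniform (subm_type V) -> uniform (subm_type V') ->
  injective e -> injective e' -> ann M (subm_type V) = ann M (subm_type V').
Proof.
move=> [indX _ injX] uV uV' ei ei'.
have ess := indecomposable_essential uV.1 (@subm_incl_inj _ _ V) ei indX injX.
have [x x0] := uV'.1.
have ex0 : e' x != 0 by apply: contraNneq x0 => ex; apply/eqP/ei'; rewrite ex linear0.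
have [r [rex [y _ ey]]] := ess _ ex0.
pose C := cyclic (r *: e' x).
have Cy z : range e (subm_incl C z).
  by have [a _ <-] := subm_incl_in z; exists (a *: y) => //; rewrite linearZ /= ey.
have Cx z : range e' (subm_incl C z).
  have [a _ <-] := subm_incl_in z; exists (a *: (r *: x)) => //.
  by rewrite !linearZ.
have [s sE] := factor_inj ei Cy; have [s' sE'] := factor_inj ei' Cx.
have nC : nonzero_module (subm_type C).
  exists (mk_sub (cyclic_id (r *: e' x))).
  by apply: contraNneq rex => /(congr1 (subm_incl C)) /= ->.
have inj_of Y (i : {linear Y -> X}) (t : {linear subm_type C -> Y}) :
    i \o t =1 subm_incl C -> injective t.
  by move=> it a b ab; apply: subm_incl_inj; rewrite -!it /= ab.
by rewrite -(ann_embed uV nC (inj_of _ _ _ sE)) -(ann_embed uV' nC (inj_of _ _ _ sE')).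
Qed.

Hypothesis unif_M : forall N : submodule M, N <> [set 0] :> set M ->
  exists U : submodule M, U `<=` N /\ uniform (subm_type U).

(** Since [X] is not torsion there is a nonzero map [f] from [X] to a hull of [M].
    Pull [M] back to [p : X' -> M]. A nonzero [g : M -> im p] lifts to
    [h : M -> X'], and the kernel of [g] is not essential, so that [h] is injective
    on some nonzero cyclic submodule, hence on a uniform one. *)
Lemma class_uniform X : class X ->
  exists V, uniform (subm_type V) /\ exists e : {linear subm_type V -> X}, injective e.
Proof.
move=> [[[x x0] _] [sX tfX] injX].
have [E [i [hullE [f [y fy]]]]] : exists (E : lmodType R) (i : {linear M -> E}),
    injective_hull M i /\ exists (f : {linear subm_type (subm_full X) -> E}) y, f y != 0.
  apply: contrapT => h; have T0 : subm_full X = [set 0] :> set X.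
    apply: tfX; split; first exact: sigma_sub (@subm_incl_inj _ _ _) sX.
    move=> E i hE f y; apply: contrapT => /eqP fy; apply: h.
    by exists E, i; split=> //; exists f, y.
  by case/eqP: x0; have : subm_set (subm_full X) x by []; rewrite T0.
have [_ /essential_monoP[ii ess]] := hullE.
have [r [rfy [m _ im_m]]] := ess _ fy.
pose X' := subm_preim f (im i).
have X'i z : range i ((f \o subm_incl X') z) by exact: (subm_incl_in z).
have [p pE] := factor_inj ii X'i.
have pN0 : im p <> subm0 M.
  move=> p0; have X'y : subm_set X' (r *: y) by exists m; rewrite // linearZ.
  have : subm_set (im p) (p (mk_sub X'y)) by exists (mk_sub X'y).
  rewrite p0 => pz; case/eqP: rfy.
  by have /= := pE (mk_sub X'y); rewrite pz linear0 linearZ.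
have [g [k [gp _ gk]]] := exists_into_neq0 proj_M semiprime_M pN0.
have sX' : in_sigma M (subm_type X').
  apply: (sigma_sub (f := subm_incl (subm_full X) \o subm_incl X')) sX.
  exact: inj_comp (@subm_incl_inj _ _ _) (@subm_incl_inj _ _ _).
have [h hE] := projective_lift proj_M sX' (sigma_M M) gp.
have [w [w0 wg]] : exists w, w != 0 /\ forall s : R, g (s *: w) = 0 -> s *: w = 0.
  apply: contrapT => nw; case/eqP: gk.
  apply: (essential_kernel_eq0 proj_M semiprime_M acc_M) => w w0.
  apply: contrapT => ns; apply: nw; exists w; split=> // s gs.
  by apply: contrapT => /eqP sw; apply: ns; exists s.
have [V [Vw uV]] := unif_M (cyclic_neq0 w0).
exists V; split=> //.
exists (subm_incl (subm_full X) \o (subm_incl X' \o (h \o subm_incl V))).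
apply: inj_comp (@subm_incl_inj _ _ _) _; apply: inj_comp (@subm_incl_inj _ _ _) _.
apply: raddf_inj => v hv; apply: subm_incl_inj; rewrite linear0.
have [s _ sw] := Vw _ (subm_incl_in v).
rewrite -[LHS]sw; apply: wg; rewrite sw -[g _]hE /=.
by rewrite -[h _]/((h \o subm_incl V) v) hv linear0.
Qed.

(** An embedding [V' -> V] extends to an injective map between the hulls [X'] and
    [X], whose image is a direct summand. *)
Lemma class_iso X X' V V' (e : {linear subm_type V -> X}) (e' : {linear subm_type V' -> X'}) :
  class X -> class X' -> uniform (subm_type V) -> uniform (subm_type V') ->
  injective e -> injective e' -> ann M (subm_type V) = ann M (subm_type V') ->
  isomorphic X' X.
Proof.
move=> [indX _ injX] [indX' _ injX'] uV uV' ei ei' annE.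
have [k ki] := ann_eq_embed proj_M semiprime_M acc_M uV uV' annE.
have ess := indecomposable_essential uV'.1 (@subm_incl_inj _ _ V') ei' indX' injX'.
have [g gE] := injX.2 _ _ e' (e \o k) (sigma_subM V') injX'.1 ei'.
exists g; apply: (injective_summand injX' indX'.1 indX injX.1).
by apply: (essential_inj ess) => a b; rewrite !gE => /ei /ki.
Qed.

(** The hull of [U] is torsion free because it embeds in the hull of [M]. *)
Lemma class_hull U : uniform (subm_type U) ->
  exists2 X, class X & exists e : {linear subm_type U -> X}, injective e.
Proof.
move=> uU; have [X [i [injX /essential_monoP[ii ess]]]] := hull_exists (@subm_incl_inj _ _ U).
exists X; last by exists i.
split=> //; first exact: uniform_hull_indecomposable ess.
split=> [|N [sN torN]]; first exact: injX.1.
have [E [k hullE]] := @hull_exists _ M M idfun (fun _ _ h => h).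
have [injE /essential_monoP[ki _]] := hullE.
have [phi phiE] := injE.2 _ _ i (k \o subm_incl U) (sigma_subM U) injX.1 ii.
have phii : injective phi.
  apply: (essential_inj ess) => a b; rewrite !phiE.
  by move=> /ki /subm_incl_inj.
apply: subm_eq0 => x Nx; apply: phii; rewrite linear0.
exact: (torN E k hullE (phi \o subm_incl N) (mk_sub Nx)).
Qed.

End Correspondence.

Theorem theorem2p7 (R : pzRingType) (M : lmodType R)
    (proj_M : projective_in_sigma M M)
    (semiprime_M : semiprime_module M)
    (acc_M : ACC (annihilators M))
    (unif_M : forall N : submodule M, N <> [set 0] :> set M ->
       exists U : submodule M, U `<=` N /\ uniform (subm_type U)) :
  forall E : module_class R, is_Etau M (chi M) E ->
    exists f : {X : lmodType R | E X} -> {P : submodule M | SpecMin M P},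
      bijective f.
Proof.
move=> E [Eclass Ecomplete Euniq].
have exV (X : {X | E X}) : exists V : submodule M, uniform (subm_type V) /\
    exists e : {linear subm_type V -> sval X}, injective e.
  exact: class_uniform (Eclass _ (svalP X)).
pose V X := projT1 (cid (exV X)).
have uV X : uniform (subm_type (V X)) by exact: (projT2 (cid (exV X))).1.
have eV X : exists e : {linear subm_type (V X) -> sval X}, injective e.
  exact: (projT2 (cid (exV X))).2.
exists (fun X => exist _ _ (SpecMin_ann proj_M semiprime_M acc_M (uV X))).
apply: surj_bij => [X X' /(congr1 sval) /= annE|[P minP]].
  have [e ei] := eV X; have [e' ei'] := eV X'.
  apply: (eq_sig_hprop (fun _ => @Prop_irrelevance _)).
  apply: Euniq; try exact: svalP.
  apply: (class_iso proj_M semiprime_M acc_M _ _ (uV X') (uV X) ei' ei (esym annE));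
    exact: Eclass _ (svalP _).
have [U uU PU] := SpecMin_is_ann proj_M semiprime_M acc_M unif_M minP.
have [X0 cX0 [e0 ei0]] := class_hull uU.
have [X EX [g bg]] := Ecomplete _ cX0.
exists (exist _ X EX); apply: eq_exist => /=; rewrite PU.
have [e ei] := eV (exist _ X EX).
apply: (class_ann proj_M semiprime_M acc_M (Eclass _ EX) (uV _) uU ei (e' := g \o e0)).
exact: inj_comp (bij_inj bg) ei0.
Qed.
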